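(* $\mathcal{S}_2\setminus \mathcal{S}_3\neq \emptyset$, that is, there exists a continuous function $f:\mathbb{R}\to\mathbb{R}$ with $f(0)=0$ which is $2$-subadditive but not $3$-subadditive. In particular, $\mathcal{S}_1\neq \mathcal{S}_2$, and the family $(\mathcal{S}_a: a>0)$ is not increasing, i.e., it is not true that $\mathcal{S}_a\subseteq \mathcal{S}_b$ for all reals $0<a<b$.
   Context: For a real $a>0$, a function $f:\mathbb{R}\to\mathbb{R}$ is called $a$-subadditive if $f(ax+y)\le a f(x)+f(y)$ for all $x,y\in\mathbb{R}$. For each real $a>0$, $\mathcal{S}_a$ denotes the family of all continuous $a$-subadditive functions $f:\mathbb{R}\to\mathbb{R}$ such that $f(0)=0$. *)

(* Defs.v *)
From HB Require Import structures.
From mathcomp Require Import all_boot all_order all_algebra.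
From mathcomp Require Import all_classical all_reals all_analysis.

Set Implicit Arguments.
Unset Strict Implicit.
Unset Printing Implicit Defensive.

Import Order.TTheory GRing.Theory Num.Theory.
Import numFieldNormedType.Exports.

Local Open Scope classical_set_scope.
Local Open Scope ring_scope.

(* The next two definitions are only meaningful for [0 < a]. *)
Definition a_subadditive (R : realType) (a : R) (f : R -> R) : Prop :=
  forall x y : R, f (a * x + y) <= a * f x + f y.

Definition subadd_family (R : realType) (a : R) : set (R -> R) :=
  [set f | [/\ continuous f, a_subadditive a f & f 0 = 0]].

(* Main.v *)
Require Import Defs.
From HB Require Import structures.
From mathcomp Require Import all_boot all_order all_algebra.
From mathcomp Require Import all_classical all_reals all_analysis.
From mathcomp Require Import ring lra.

Set Implicit Arguments.
Unset Strict Implicit.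
Unset Printing Implicit Defensive.

Import Order.TTheory GRing.Theory Num.Theory.
Import numFieldNormedType.Exports.

Local Open Scope classical_set_scope.
Local Open Scope ring_scope.

(* The witness is f = c o sin, where c(s) = max(-s, min(s, 1/2)) is |s| capped
   at 1/2 on the positive side only.  As sin (2x + y) - sin y =
   2 sin x cos (x + y) and c is 1-Lipschitz with values in [0, 1], the increment
   f (2x + y) - f y is at most min(2 |sin x|, 1) <= 2 f x.  But f pi = 0, while
   f takes different values at the points pi/2 and 3pi/2, which differ by an odd
   multiple of pi; so f is neither 3-subadditive nor subadditive. *)

Definition capped_sin (R : realType) (x : R) : R :=
  Num.max (- sin x) (Num.min (sin x) 2^-1).

Lemma continuous_capped_sin (R : realType) : continuous (@capped_sin R).
Proof.
move=> x; apply: (@continuous_max _ _ (fun x => - sin x)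
  (fun x => Num.min (sin x) 2^-1)).
  by apply: cvgN; exact: continuous_sin.
apply: (@continuous_min _ _ sin (fun=> 2^-1)); first exact: continuous_sin.
exact: cvg_cst.
Qed.

Lemma capped_sin_pi (R : realType) : capped_sin (pi : R) = 0.
Proof. by rewrite /capped_sin sinpi oppr0 min_l ?maxxx ?invr_ge0. Qed.

Lemma capped_sin_pihalf (R : realType) : capped_sin (pi / 2 : R) = 2^-1.
Proof. by rewrite /capped_sin sin_pihalf min_r ?max_r; lra. Qed.

Lemma capped_sin_pihalfDpi (R : realType) : capped_sin (pi / 2 + pi : R) = 1.
Proof.
by rewrite /capped_sin sinDpi sin_pihalf opprK max_l // ge_min; apply/orP; left; lra.
Qed.

Lemma capped_sinD2pi (R : realType) (x : R) :
  capped_sin (x + pi *+ 2) = capped_sin x.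
Proof. by rewrite /capped_sin sinD2pi. Qed.

Lemma ler_norm_sinD2B (R : realType) (x y : R) :
  `|sin (2 * x + y) - sin y| <= 2 * `|sin x|.
Proof.
have -> : sin (2 * x + y) - sin y = 2 * (sin x * cos (x + y)).
  (* Both arguments are centred at [x + y], so the [sin (x + y) * cos x] terms of the two addition
     formulas cancel. *)
  have -> : 2 * x + y = (x + y) + x by ring.
  have -> : sin y = sin ((x + y) - x) by congr sin; ring.
  by rewrite sinD sinB; ring.
by rewrite !normrM normr_nat ler_pM2l // ler_piMr // cos_max.
Qed.

Lemma capped_sin_2subadditive (R : realType) : a_subadditive 2 (@capped_sin R).
Proof.
move=> x y; have := ler_norm_sinD2B x y.
(* This bound serves the capped case [sin x > 1/2]: there twice the value at [x] is only 1, and the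
   value at [2 * x + y] must not exceed it. *)
have := sin_geN1 (2 * x + y).
rewrite /capped_sin; move: (sin (2 * x + y)) (sin x) (sin y) => u s t.
rewrite ler_norml => u_ge /andP[].
(* Once the sign of [s] removes the absolute value, each branch of the max and min is linear in [u],
   [s], [t]. *)
rewrite !maxEle !minEle; case: (lerP 0 s) => s0;
  [rewrite ger0_norm // | rewrite ltr0_norm //]; do 6?case: ifP => /idP; lra.
Qed.

Lemma capped_sin_not_1subadditive (R : realType) :
  ~ a_subadditive 1 (@capped_sin R).
Proof.
(* The term at [pi] vanishes, leaving the false [1 <= 1/2]. *)
move=> /(_ pi (pi / 2)).
rewrite mul1r addrC capped_sin_pihalfDpi capped_sin_pi capped_sin_pihalf; lra.
Qed.

Lemma capped_sin_not_3subadditive (R : realType) :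
  ~ a_subadditive 3 (@capped_sin R).
Proof.
move=> /(_ pi (pi / 2)).
(* Dropping a full period leads back to the values compared for [a = 1]. *)
have -> : 3 * pi + pi / 2 = pi / 2 + pi + pi *+ 2 :> R by ring.
rewrite capped_sinD2pi capped_sin_pihalfDpi capped_sin_pi capped_sin_pihalf; lra.
Qed.

Lemma capped_sin_subadd_family2 (R : realType) :
  subadd_family 2 (@capped_sin R).
Proof.
split; [exact: continuous_capped_sin | exact: capped_sin_2subadditive |].
by rewrite /capped_sin sin0 oppr0 min_l ?maxxx ?invr_ge0.
Qed.

Theorem theorem1p5 (R : realType) :
  [/\ subadd_family (2 : R) `\` subadd_family (3 : R) !=set0,
      exists f : R -> R,
        [/\ continuous f, f 0 = 0, a_subadditive 2 f & ~ a_subadditive 3 f],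
      subadd_family (1 : R) <> subadd_family (2 : R)
    & ~ (forall a b : R, 0 < a -> a < b ->
           subadd_family a `<=` subadd_family b)].
Proof.
have f2 := @capped_sin_subadd_family2 R.
have f3 := @capped_sin_not_3subadditive R.
split.
- by exists (@capped_sin R); split=> // -[].
- by exists (@capped_sin R); case: f2.
- by move=> S12; move: f2; rewrite -S12 => -[_ /capped_sin_not_1subadditive].
(* Monotonicity already fails for the pair [2 < 3]. *)
- move=> S_incr; have [_ /f3 []] : subadd_family 3 (@capped_sin R).
  by apply: (S_incr 2) => //; lra.
Qed.
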